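(* Let $L$ satisfy (1)–(3) of the context and fix $h>0$. Then there exists a separating subaction, i.e. a continuous function $u:\mathbb{T}^N\to\mathbb{R}$ such that $$\max_{v\in\mathbb{R}^N}\{u(x+hv)-u(x)-hL(x,v)\}\le-h\overline H_h\quad\text{for all }x\in\mathbb{T}^N,$$ and, for $x\in\mathbb{T}^N$, $$\max_{v\in\mathbb{R}^N}\{u(x+hv)-u(x)-hL(x,v)\}=-h\overline H_h\iff x\in\Omega_h(L).$$
   Context: $\mathbb{T}^N=\mathbb{R}^N/\mathbb{Z}^N$; functions on $\mathbb{T}^N$ are identified with $\mathbb{Z}^N$-periodic functions on $\mathbb{R}^N$. The Lagrangian $L:\mathbb{R}^N\times\mathbb{R}^N\to\mathbb{R}$ is of class $C^2$, $\mathbb{Z}^N$-periodic in $x$, and satisfies: (1) $\lim_{|v|\to\infty}L(x,v)/|v|=+\infty$ uniformly in $x$; (2) the Hessian $\left(\partial^2L/\partial v_i\partial v_j\right)(x,v)$ is positive definite; (3) there are constants $C,\Gamma>0$ with $L(x+y,v-z)+L(x-y,v+z)-2L(x,v)\le C|y|^2+\Gamma|z|^2$ for all $x,y,v,z$. $\mathcal M_h$ is the set of Borel probability measures $\mu$ on $\mathbb{T}^N\times\mathbb{R}^N$ with $\int(\varphi(x+hv)-\varphi(x))\,d\mu=0$ for all $\varphi\in C(\mathbb{T}^N)$, and $\overline H_h=\min_{\mu\in\mathcal M_h}\int L\,d\mu$. A $k$-path from $x$ to $z$ ($x,z\in\mathbb{R}^N$) is a sequence $(x_0,\dots,x_k)$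 in $\mathbb{R}^N$ with $x_0=x$, $x_k=z$; put $v_j=(x_{j+1}-x_j)/h$. Its action is $A_{L-\overline H_h}(x_0,\dots,x_k)=h\sum_{i=0}^{k-1}(L(x_i,v_i)-\overline H_h)$. A point $x\in\mathbb{T}^N$ is non-wandering with respect to $L$ if for every $\epsilon>0$ there are $k\ge1$, $s\in\mathbb{Z}^N$ and a $k$-path $(x_0,\dots,x_k)$ from $x+s$ to $x$ with $|A_{L-\overline H_h}(x_0,\dots,x_k)|<\epsilon$. $\Omega_h(L)$ is the set of non-wandering points. *)

(* Defs.v *)
From HB Require Import structures.
From mathcomp Require Import all_boot all_order all_algebra.
From mathcomp Require Import generic_quotient.
From mathcomp Require Import all_classical all_reals all_analysis.

Set Implicit Arguments.
Unset Strict Implicit.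
Unset Printing Implicit Defensive.

Import Order.TTheory GRing.Theory Num.Theory.
Import numFieldNormedType.Exports.

Local Open Scope classical_set_scope.
Local Open Scope ring_scope.
Local Open Scope quotient_scope.

Section Torus.
Variables (R : realType) (N : nat).

Definition int_vec (s : 'rV[int]_N) : 'rV[R]_N := map_mx intr s.

Definition lattice_rel (x y : 'rV[R]_N) : bool :=
  `[< exists s : 'rV[int]_N, y = x + int_vec s >].

Lemma lattice_rel_refl : reflexive lattice_rel.
Proof.
by move=> x; apply/asboolP; exists 0; rewrite /int_vec map_mx0 addr0.
Qed.

Lemma lattice_rel_sym : symmetric lattice_rel.
Proof.
move=> x y; apply: asbool_equiv_eq.
by split=> -[s ->]; exists (- s); rewrite /int_vec map_mxN addrK.
Qed.

Lemma lattice_rel_trans : transitive lattice_rel.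
Proof.
move=> y x z /asboolP[s ->] /asboolP[t ->]; apply/asboolP.
by exists (s + t); rewrite /int_vec map_mxD addrA.
Qed.

Canonical lattice_equiv :=
  EquivRel lattice_rel lattice_rel_refl lattice_rel_sym lattice_rel_trans.

Definition torus : Type := quotient_topology {eq_quot lattice_equiv}.

HB.instance Definition _ := Quotient.on torus.
HB.instance Definition _ := Topological.on torus.
HB.instance Definition _ := Pointed.on torus.

(* Translation on the torus; [repr] picks a representative in [R^N], whose
   choice does not affect the result. *)
Definition tshift (x : torus) (w : 'rV[R]_N) : torus := \pi_torus (repr x + w).

End Torus.

Section Lagrangian.
Variables (R : realType) (N : nat).
Local Notation V := 'rV[R]_N.

(* The library norm on matrices is the sup norm. *)
Definition enorm (v : V) : R := Num.sqrt (\sum_(i < N) v 0 i ^+ 2).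

Definition coord_dir (i : 'I_N + 'I_N) : V * V :=
  match i with
  | inl i => (delta_mx 0 i, 0)
  | inr i => (0, delta_mx 0 i)
  end.

(* Class C^k on [R^N * R^N]: all partial derivatives of order at most k exist
   and are continuous. *)
Fixpoint class_C (k : nat) (F : V * V -> R) : Prop :=
  continuous F /\
  match k with
  | 0 => True
  | k'.+1 => forall i : 'I_N + 'I_N,
      (forall p, derivable F p (coord_dir i)) /\
      class_C k' ('D_(coord_dir i) F)
  end.

Definition hessian_v (L : V -> V -> R) (x v : V) : 'M[R]_N :=
  \matrix_(i < N, j < N) 'D_(delta_mx 0 i) ('D_(delta_mx 0 j) (L x)) v.

Definition posdef (M : 'M[R]_N) : Prop :=
  forall z : V, z != 0 -> 0 < (z *m M *m z^T) 0 0.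

Definition periodic_x (L : V -> V -> R) : Prop :=
  forall (s : 'rV[int]_N) (x v : V), L (x + int_vec R s) v = L x v.

Definition superlinear (L : V -> V -> R) : Prop :=
  forall A : R, exists r : R, forall x v : V,
    r < enorm v -> A < L x v / enorm v.

Definition semiconcave (L : V -> V -> R) : Prop :=
  exists C Gamma : R, [/\ 0 < C, 0 < Gamma &
    forall x y v z : V,
      L (x + y) (v - z) + L (x - y) (v + z) - 2 * L x v
        <= C * enorm y ^+ 2 + Gamma * enorm z ^+ 2].

Record admissible_lagrangian (L : V -> V -> R) : Prop := AdmissibleLagrangian {
  lagrangian_C2 : class_C 2 (fun p => L p.1 p.2) ;
  lagrangian_periodic : periodic_x L ;
  lagrangian_superlinear : superlinear L ;
  lagrangian_posdef : forall x v : V, posdef (hessian_v L x v) ;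
  lagrangian_semiconcave : semiconcave L }.

End Lagrangian.

Section Discrete.
Variables (R : realType) (N : nat).
Local Notation V := 'rV[R]_N.

Definition phase : Type := (torus R N * V)%type.

HB.instance Definition _ := Topological.on phase.
HB.instance Definition _ := Pointed.on phase.

(* Its measurable sets are the Borel sets. *)
Definition borel_phase : Type := g_sigma_algebraType (@open phase).

HB.instance Definition _ := Measurable.on borel_phase.

Definition holonomic (h : R) : set (probability borel_phase R) :=
  [set mu | forall phi : torus R N -> R, continuous phi ->
    (\int[mu]_(p in [set: borel_phase])
      (phi (tshift p.1 (h *: p.2)) - phi p.1)%:E = 0)%E].

(* The integral is extended-real valued: [L] is bounded below but need not be
   integrable for every holonomic measure.  For an admissible [L] the infimum
   is finite and attained, i.e. it is the minimum. *)
Definition Hbar (h : R) (L : V -> V -> R) : R :=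
  fine (ereal_inf
    [set (\int[mu]_(p in [set: borel_phase]) (L (repr p.1) p.2)%:E)%E
      | mu in holonomic h]).

(* Only [p 0], ..., [p k] are relevant. *)
Definition action (h : R) (L : V -> V -> R) (k : nat) (p : nat -> V) : R :=
  h * \sum_(i < k) (L (p i) (h^-1 *: (p i.+1 - p i)) - Hbar h L).

Definition nonwandering (h : R) (L : V -> V -> R) : set (torus R N) :=
  [set x | forall eps : R, 0 < eps ->
    exists (k : nat) (s : 'rV[int]_N) (p : nat -> V),
      [/\ (1 <= k)%N, p 0%N = repr x + int_vec R s, p k = repr x &
          `|action h L k p| < eps]].

End Discrete.

Definition is_max (R : realType) (S : set R) (m : R) : Prop :=
  S m /\ ubound S m.

(* Main.v *)
Require Import Defs.
From HB Require Import structures.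
From mathcomp Require Import all_boot all_order all_algebra.
From mathcomp Require Import generic_quotient.
From mathcomp Require Import all_classical all_reals all_analysis.
From mathcomp Require Import measurable_realfun.
From mathcomp Require Import ring lra.

Set Implicit Arguments.
Unset Strict Implicit.

Import Order.TTheory GRing.Theory Num.Theory.
Import numFieldNormedType.Exports.
Local Open Scope classical_set_scope.
Local Open Scope ring_scope.

(** Write [e x y = h (L x ((y - x)/h) - Hbar)] for the cost of one step, [D x y] for its
    infimum over the integer translates of [y], and [S x y] for the infimum over all
    chains from [x] to [y] of the sum of [D] (the Mane potential).  The uniform measure
    on a closed path is holonomic, so closed paths have nonnegative action; hence [S] is
    finite, every [S q] is a subaction, and [x] is non-wandering iff [S x x <= 0].
    Since [S x y - S x x <= D x y - S x x], the subaction [S x] is strict at [x] as soon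
    as [S x x > 0].  Averaging [S q] with positive weights over a countable dense set
    of points [q] therefore yields a separating subaction: if the average is calibrated
    along a step from [x] to [y], then so is every [S q], and by continuity in [q] also
    [S x], which forces [S x x <= 0]. *)

(** * The Mane potential of an abstract cost without negative cycles *)

Section ManePotential.
Variables (R : realType) (T : Type) (D : T -> T -> R).

(** The list holds only the intermediate points, so a chain has at least one step. This keeps
    [potential x x] from being trivially nonpositive. *)
Fixpoint chain_cost (x : T) (l : seq T) (y : T) : R :=
  if l is z :: l' then D x z + chain_cost z l' y else D x y.

Lemma chain_cost_cat x l z l' y :
  chain_cost x (l ++ z :: l') y = chain_cost x l z + chain_cost z l' y.
Proof. by elim: l x => //= w l IHl x; rewrite IHl addrA. Qed.

(** Only the first step sees the starting point, so the error is paid once, whatever the length of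
    the chain. *)
Lemma chain_cost_le_l x x' l y (eps : R) : (forall z, D x z <= D x' z + eps) ->
  chain_cost x l y <= chain_cost x' l y + eps.
Proof. by case: l => //= z l H; have := H z; lra. Qed.

Lemma chain_cost_le_r x l y y' (eps : R) : (forall z, D z y <= D z y' + eps) ->
  chain_cost x l y <= chain_cost x l y' + eps.
Proof. by move=> H; elim: l x => //= z l IHl x; have := IHl z; lra. Qed.

Definition potential (x y : T) : R := inf [set chain_cost x l y | l in setT].

Hypothesis cycle_ge0 : forall x l, 0 <= chain_cost x l x.

(** One step from [y] back to [x] closes the chain into a cycle. This is what keeps the infimum in
    [potential] finite. *)
Lemma chain_cost_ge x l y : - D y x <= chain_cost x l y.
Proof. by have := cycle_ge0 x (l ++ [:: y]); rewrite chain_cost_cat /=; lra. Qed.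

Lemma potential_le x l y : potential x y <= chain_cost x l y.
Proof.
apply: ge_inf; last by exists l.
by exists (- D y x) => _ [l' _ <-]; exact: chain_cost_ge.
Qed.

Lemma le_potential x y (a : R) : (forall l, a <= chain_cost x l y) ->
  a <= potential x y.
Proof.
move=> H; apply: lb_le_inf; first by exists (chain_cost x [::] y), [::].
by move=> _ [l _ <-].
Qed.

Lemma potential_ge x y : - D y x <= potential x y.
Proof. by apply: le_potential => l; exact: chain_cost_ge. Qed.

Lemma potential_leD x y : potential x y <= D x y.
Proof. exact: (potential_le x [::] y). Qed.

Lemma potential_chain x y (eps : R) : 0 < eps ->
  exists l, chain_cost x l y < potential x y + eps.
Proof.
move=> e0; apply: contrapT => /forallNP H.
have /(@le_potential x y) : forall l, potential x y + eps <= chain_cost x l y.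
  by move=> l; rewrite leNgt; apply/negP/H.
by lra.
Qed.

(** Every chain to [y] extends by one step to [z]; thus each [potential x] is a subaction for the
    cost [D]. *)
Lemma potential_step x y z : potential x z <= potential x y + D y z.
Proof.
rewrite -lerBlDr; apply: le_potential => l; rewrite lerBlDr.
by have := potential_le x (l ++ [:: y]) z; rewrite chain_cost_cat.
Qed.

Lemma potential_le_l x x' y (eps : R) : (forall z, D x z <= D x' z + eps) ->
  potential x y <= potential x' y + eps.
Proof.
move=> H; rewrite -lerBlDr; apply: le_potential => l; rewrite lerBlDr.
exact: le_trans (potential_le x l y) (chain_cost_le_l _ _ H).
Qed.

Lemma potential_le_r x y y' (eps : R) : (forall z, D z y <= D z y' + eps) ->
  potential x y <= potential x y' + eps.
Proof.
move=> H; rewrite -lerBlDr; apply: le_potential => l; rewrite lerBlDr.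
exact: le_trans (potential_le x l y) (chain_cost_le_r _ _ H).
Qed.

End ManePotential.

(** * Dyadically weighted averages of a bounded sequence of functions *)

Section DyadicAverage.
Variables (R : realType) (T : Type) (f : nat -> T -> R) (B : R).
Hypothesis f_bounded : forall n x, `|f n x| <= B.

Definition dyadic_sum (n : nat) (x : T) : R :=
  \sum_(0 <= i < n) 2^-1 ^+ i.+1 * f i x.

Definition dyadic_average (x : T) : R := limn (dyadic_sum ^~ x).

Lemma dyadic_weight_sum n : \sum_(0 <= i < n) (2^-1 : R) ^+ i.+1 = 1 - 2^-1 ^+ n.
Proof.
elim: n => [|n IHn]; first by rewrite big_nil expr0 subrr.
by rewrite big_nat_recr //= IHn exprS; lra.
Qed.

Lemma dyadic_weight_cvg0 : (fun n => (2^-1 : R) ^+ n) @ \oo --> (0 : R).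
Proof. by apply: cvg_expr; rewrite ger0_norm //; lra. Qed.

Lemma dyadic_sum_cvg x : dyadic_sum ^~ x @ \oo --> dyadic_average x.
Proof.
suff : cvgn (series (fun i => (2^-1 : R) ^+ i.+1 * f i x)) by [].
apply: normed_cvg.
apply: (series_le_cvg _ _ _ (is_cvg_geometric_series (a := B) (z := 2^-1) _)).
- by move=> n; exact: normr_ge0.
- by move=> n; rewrite /geometric /= mulr_ge0 ?exprn_ge0 //;
    exact: le_trans (f_bounded 0 x).
- move=> n; rewrite /geometric /= normrM ger0_norm ?exprn_ge0 // mulrC.
  apply: ler_pM => //; rewrite exprS.
  by rewrite -[leRHS]mul1r ler_wpM2r ?exprn_ge0 //; lra.
- by rewrite ger0_norm //; lra.
Qed.

(** The weights sum to 1, so a common bound on increments passes to the average, and a defect [eta]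
    at index [m] survives multiplied by its weight. *)
Lemma dyadic_average_gap m (eta a : R) x y : 0 <= eta ->
  (forall n, f n y - f n x <= a) -> f m y - f m x <= a - eta ->
  dyadic_average y - dyadic_average x <= a - 2^-1 ^+ m.+1 * eta.
Proof.
move=> eta0 fa fm.
(* The defect is visible only once the partial sum contains the index [m]. *)
have bound n : (m < n)%N -> dyadic_sum n y - dyadic_sum n x <=
    a * (1 - 2^-1 ^+ n) - 2^-1 ^+ m.+1 * eta.
  move=> mn; rewrite /dyadic_sum -sumrB -dyadic_weight_sum mulr_sumr.
  rewrite (bigD1_seq m) ?mem_index_iota ?iota_uniq //=.
  rewrite [X in _ <= X - _](bigD1_seq m) ?mem_index_iota ?iota_uniq //=.
  have term i (b : R) : f i y - f i x <= b ->
      2^-1 ^+ i.+1 * f i y - 2^-1 ^+ i.+1 * f i x <= b * 2^-1 ^+ i.+1.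
    by move=> fb; rewrite -mulrBr mulrC ler_wpM2r // exprn_ge0.
  have := @ler_sum R nat (index_iota 0 n) (fun i => i != m) _ _
    (fun i _ => term i a (fa i)).
  by have := term m _ fm; lra.
have cvgl : dyadic_sum n y - dyadic_sum n x @[n --> \oo] -->
    dyadic_average y - dyadic_average x.
  by apply: cvgB; exact: dyadic_sum_cvg.
have cvgr : (fun n => a * (1 - 2^-1 ^+ n) - 2^-1 ^+ m.+1 * eta) @ \oo -->
    a - 2^-1 ^+ m.+1 * eta.
  rewrite -[X in _ --> X - _](mulr1 a) -[X in _ --> a * X - _](subr0 1).
  apply: cvgB; last exact: cvg_cst.
  apply: cvgM; first exact: cvg_cst.
  by apply: cvgB; [exact: cvg_cst|exact: dyadic_weight_cvg0].
apply: ler_cvg_to cvgl cvgr _; exists m.+1 => // n /=; exact: bound.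
Qed.

Lemma dyadic_average_le (a : R) x y : (forall n, f n y - f n x <= a) ->
  dyadic_average y - dyadic_average x <= a.
Proof.
move=> fa; have := @dyadic_average_gap 0 0 a x y (lexx _) fa.
by rewrite mulr0 !subr0; apply; exact: fa.
Qed.

(** All weights are positive: strict inequality at a single index would make the increment of the
    average strictly less than [a]. *)
Lemma dyadic_average_eq (a : R) x y : (forall n, f n y - f n x <= a) ->
  dyadic_average y - dyadic_average x = a -> forall n, f n y - f n x = a.
Proof.
move=> fa Ua n; apply/eqP; rewrite eq_le fa /= leNgt; apply/negP => fn.
have w0 : 0 < (2^-1 : R) ^+ n.+1 by rewrite exprn_gt0.
have eta0 : 0 < a - (f n y - f n x) by lra.
have := @dyadic_average_gap n _ a x y (ltW eta0) fa.
rewrite Ua subKr lexx => /(_ isT).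
by have := mulr_gt0 w0 eta0; lra.
Qed.

End DyadicAverage.

(** Stronger than uniform continuity on [K]: only [p] lies in [K], while [q] may leave it. *)
Lemma continuous_uniform_on_compact (R : realType) (T : pseudoMetricType R)
    (f : T -> R) (K : set T) (eps : R) :
  compact K -> continuous f -> 0 < eps ->
  exists2 delta : R, 0 < delta &
    forall p q, K p -> ball p delta q -> `|f p - f q| < eps.
Proof.
move=> /compact_near_coveringP cK cf e0.
have e20 : 0 < eps / 2 by lra.
have := cK R (0 : R)^'+ (fun d p => forall q, ball p d q -> `|f p - f q| < eps) _.
case=> [p Kp|d /= d0 Hd].
  have /nbhs_ballP[r /= r0 Hr] : \forall q \near p, `|f p - f q| < eps / 2.
    by move/cvgrPdist_lt: (cf p); apply.
  (* Halving [r] keeps every [q] within [d] of [p'] inside the ball of radius [r] around [p]. *)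
  exists (ball p (r / 2), [set d | d < r / 2]).
    split => /=; first by apply: nbhsx_ballx; lra.
    by apply: nbhs_right_lt; lra.
  move=> [p' d] /= [pp' dr] q p'q.
  have pq : ball p r q.
    have -> : r = r / 2 + r / 2 by lra.
    apply: ball_triangle pp' _; apply: le_ball p'q; exact: ltW.
  have pp : ball p r p' by apply: le_ball pp'; lra.
  have -> : f p' - f q = (f p - f q) - (f p - f p') by ring.
  apply: le_lt_trans (ler_normB _ _) _.
  by have := Hr _ pq; have := Hr _ pp => /=; lra.
exists (d / 2); first lra.
move=> p q Kp; apply: (Hd (d / 2)) => //=; last lra.
by rewrite sub0r normrN gtr0_norm; lra.
Qed.

(** * Periodic coercive costs and their infimum over integer translates *)

Section TorusCost.
Variables (R : realType) (N : nat).
Local Notation V := 'rV[R]_N.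
Variable e : V -> V -> R.
Hypothesis e_continuous : continuous (fun p : V * V => e p.1 p.2).
Hypothesis e_periodic : forall s (x y : V),
  e (x + int_vec R s) (y + int_vec R s) = e x y.
Hypothesis e_coercive : forall A : R, exists M : R, forall x y : V,
  e x y <= A -> `|y - x| <= M.

Lemma lattice_near (x : V) : exists s, `|x + int_vec R s| <= 1.
Proof.
exists (map_mx (fun t => - Num.floor t) x).
rewrite [leLHS]/Num.norm /= mx_normrE; apply: bigmax_le => //= -[i j] _ /=.
have := floor_itv (x i j); rewrite !mxE intrD mulrNz => /andP[].
by move=> ? ?; rewrite ger0_norm; lra.
Qed.

Lemma closed_ball0_compact (M : R) : compact [set v : V | `|v| <= M].
Proof.
apply: bounded_closed_compact.
  by exists M; split; [exact: num_real|move=> A MA v /= vM; exact: le_trans vM (ltW MA)].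
rewrite (_ : mkset _ = (fun v : V => `|v|) @^-1` [set r | r <= M]) //.
apply: closed_comp; last exact: closed_le.
by move=> v _; exact: norm_continuous.
Qed.

(** A common integer translation brings [x] into the unit ball, and with it the pair into a compact
    set. The next lemma uses the same reduction. *)
Lemma cost_bounded (M : R) : exists K : R, forall x y : V, `|y - x| <= M ->
  `|e x y| <= K.
Proof.
have cK : compact ([set v : V | `|v| <= 1] `*` [set v : V | `|v| <= M + 1]).
  by apply: compact_setX; exact: closed_ball0_compact.
have /compact_bounded[K [_ HK]] : compact
    [set e p.1 p.2 | p in [set v : V | `|v| <= 1] `*` [set v : V | `|v| <= M + 1]].
  exact: continuous_compact (continuous_subspaceT e_continuous) cK.
exists (K + 1) => x y xy; have [s xs] := lattice_near x.
rewrite -(e_periodic s); apply: HK; first by rewrite ltrDl.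
exists (x + int_vec R s, y + int_vec R s) => //; split => //=.
have -> : y + int_vec R s = (y - x) + (x + int_vec R s) by rewrite addrA subrK.
exact: le_trans (ler_normD _ _) (lerD xy xs).
Qed.

Lemma cost_uniform (M eps : R) : 0 < eps -> exists2 delta : R, 0 < delta &
  forall x y x' y' : V, `|y - x| <= M -> `|x - x'| < delta -> `|y - y'| < delta ->
  `|e x y - e x' y'| < eps.
Proof.
move=> e0.
have cK : compact ([set v : V | `|v| <= 1] `*` [set v : V | `|v| <= M + 1]).
  by apply: compact_setX; exact: closed_ball0_compact.
have [d d0 Hd] := continuous_uniform_on_compact cK e_continuous e0.
exists d => // x y x' y' xy xx' yy'; have [s xs] := lattice_near x.
rewrite -(e_periodic s x) -(e_periodic s x').
have /= := Hd (x + int_vec R s, y + int_vec R s) (x' + int_vec R s, y' + int_vec R s).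
apply.
  split => //=.
  have -> : y + int_vec R s = (y - x) + (x + int_vec R s) by rewrite addrA subrK.
  exact: le_trans (ler_normD _ _) (lerD xy xs).
by split => /=; rewrite -ball_normE /ball_ /= opprD addrACA subrr addr0.
Qed.

(** Where the cost is nonpositive, coercivity bounds the displacement, and [cost_bounded]
    applies. *)
Lemma cost_lower_bound : exists B : R, forall x y, - B <= e x y.
Proof.
have [M HM] := e_coercive 0; have [K HK] := cost_bounded M.
exists `|K| => x y; have [ey|ey] := leP (e x y) 0.
  have := HK _ _ (HM _ _ ey); have := ler_norm K; rewrite ler_norml.
  by move=> ? /andP[]; lra.
by have := normr_ge0 K; lra.
Qed.

(* Unlike [e], this is uniformly continuous and bounded on the whole of [V * V]. *)
Definition torus_cost (x y : V) : R := inf [set e x (y + int_vec R s) | s in setT].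

Lemma torus_cost_le_shift (x y : V) s : torus_cost x y <= e x (y + int_vec R s).
Proof.
have [B HB] := cost_lower_bound; apply: ge_inf; last by exists s.
by exists (- B) => _ [t _ <-].
Qed.

Lemma int_vec0 : int_vec R 0 = 0 :> V.
Proof. by rewrite /int_vec map_mx0. Qed.

Lemma int_vecD s t : int_vec R (s + t) = int_vec R s + int_vec R t :> V.
Proof. by rewrite /int_vec map_mxD. Qed.

Lemma int_vecN s : int_vec R (- s) = - int_vec R s :> V.
Proof. by rewrite /int_vec map_mxN. Qed.

Lemma torus_cost_le x y : torus_cost x y <= e x y.
Proof. by have := torus_cost_le_shift x y 0; rewrite int_vec0 addr0. Qed.

Lemma le_torus_cost (x y : V) (a : R) : (forall s, a <= e x (y + int_vec R s)) ->
  a <= torus_cost x y.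
Proof.
move=> H; apply: lb_le_inf; first by exists (e x (y + int_vec R 0)), 0.
by move=> _ [s _ <-].
Qed.

Lemma torus_cost_shift (x y : V) (eps : R) : 0 < eps ->
  exists s, e x (y + int_vec R s) < torus_cost x y + eps.
Proof.
move=> e0; apply: contrapT => /forallNP H.
have /le_torus_cost : forall s, torus_cost x y + eps <= e x (y + int_vec R s).
  by move=> s; rewrite leNgt; apply/negP/H.
by lra.
Qed.

Lemma torus_cost_periodic_r s (x y : V) : torus_cost x (y + int_vec R s) = torus_cost x y.
Proof.
apply/eqP; rewrite eq_le; apply/andP; split; apply: le_torus_cost => t.
  have -> : y + int_vec R t = y + int_vec R s + int_vec R (t - s).
    by rewrite -addrA -int_vecD [s + _]addrC subrK.
  exact: torus_cost_le_shift.
by rewrite -addrA -int_vecD; exact: torus_cost_le_shift.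
Qed.

(** For the upper bound, some translate of [y] lies within distance 1 of [x]. *)
Lemma torus_cost_bounded : exists K : R, forall x y, `|torus_cost x y| <= K.
Proof.
have [B HB] := cost_lower_bound; have [K HK] := cost_bounded 1.
exists (Num.max B K) => x y; rewrite ler_norml; apply/andP; split.
  apply: le_trans (le_torus_cost _); last by move=> s; exact: HB.
  by rewrite lerN2 le_max lexx.
have [s ys] := lattice_near (y - x).
apply: le_trans (torus_cost_le_shift x y s) _.
apply: le_trans (ler_norm _) _; rewrite le_max HK ?orbT //.
by rewrite addrAC.
Qed.

(** A nearly optimal translate of [y] has cost at most [K + eps / 2], so its displacement is bounded
    by coercivity; there [e] is uniformly continuous, and the same translate is tested for [x'] and
    [y']. *)
Lemma torus_cost_uniform (eps : R) : 0 < eps -> exists2 delta : R, 0 < delta &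
  forall x y x' y' : V, `|x - x'| < delta -> `|y - y'| < delta ->
  torus_cost x' y' <= torus_cost x y + eps.
Proof.
move=> e0; have [K HK] := torus_cost_bounded.
have [M HM] := e_coercive (K + eps / 2).
have e20 : 0 < eps / 2 by lra.
have [d d0 Hd] := cost_uniform M e20.
exists d => // x y x' y' xx' yy'.
have [s Hs] := torus_cost_shift x y e20.
apply: le_trans (torus_cost_le_shift x' y' s) _.
have xyM : `|y + int_vec R s - x| <= M.
  by apply: HM; have := HK x y; rewrite ler_norml => /andP[]; lra.
have yy : `|y + int_vec R s - (y' + int_vec R s)| < d
    by rewrite opprD addrACA subrr addr0.
by have := Hd _ _ _ _ xyM xx' yy; rewrite ltr_norml => /andP[]; lra.
Qed.

Definition path_cost (k : nat) (p : nat -> V) : R := \sum_(i < k) e (p i) (p i.+1).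

(** The path is built from its end: [y] is kept fixed, and the translations chosen at each step
    accumulate at the starting point. *)
Lemma chain_lift (x : V) l (y : V) (eps : R) : 0 < eps -> exists k s (p : nat -> V),
  [/\ p 0%N = x + int_vec R s, p k.+1 = y &
      path_cost k.+1 p < chain_cost torus_cost x l y + eps].
Proof.
elim: l x eps => [|z l IHl] x eps e0 /=.
  have [s Hs] := torus_cost_shift x y e0.
  exists 0%N, (- s), (fun i => if i is 0%N then x - int_vec R s else y).
  rewrite int_vecN; split => //; rewrite /path_cost big_ord1 /=.
  by rewrite -(e_periodic s) subrK.
have e20 : 0 < eps / 2 by lra.
have [k [t [p [p0 pk Hp]]]] := IHl z _ e20.
have [s Hs] := torus_cost_shift x z e20.
(* The lifted tail starts at [z + t], whereas the good first step goes from [x] to [z + s]; shifting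
   that step by [t - s] joins the two at no cost. *)
exists k.+1, (t - s), (fun i => if i is j.+1 then p j else x + int_vec R (t - s)).
split => //; rewrite /path_cost big_ord_recl /= p0.
have -> : z + int_vec R t = z + int_vec R s + int_vec R (t - s).
  by rewrite -addrA -int_vecD [s + _]addrC subrK.
rewrite e_periodic.
by move: Hp; rewrite /path_cost; set S := \sum_(i < k.+1) _; lra.
Qed.

End TorusCost.

(** * Continuity and Borel measurability on the quotient torus *)

Section Torus.
Local Open Scope quotient_scope.
Variables (R : realType) (N : nat).
Local Notation V := 'rV[R]_N.

Lemma pi_torusP (x y : V) :
  \pi_(torus R N) x = \pi_(torus R N) y <-> exists s, y = x + int_vec R s.
Proof.
change (x = y %[mod {eq_quot (lattice_equiv R N)}] <->
  exists s, y = x + int_vec R s).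
split => [/eqP|[s ->]]; first by rewrite eqmodE => /asboolP.
by apply/eqP; rewrite eqmodE; apply/asboolP; exists s.
Qed.

Lemma repr_pi_torus (x : V) : exists s, repr (\pi_(torus R N) x) = x + int_vec R s.
Proof. by apply/pi_torusP; rewrite reprK. Qed.

Lemma periodic_repr (Z : Type) (f : V -> Z) (x : V) :
  (forall s y, f (y + int_vec R s) = f y) -> f (repr (\pi_(torus R N) x)) = f x.
Proof. by move=> f_per; have [s ->] := repr_pi_torus x; rewrite f_per. Qed.

Lemma pi_torus_open (U : set V) : open U -> open (\pi_(torus R N) @` U).
Proof.
move=> oU; rewrite /open /= /quotient_open.
rewrite (_ : _ @^-1` _ = \bigcup_s [set x : V | U (x + int_vec R s)]).
  apply: bigcup_open => s _.
  have /continuousP : continuous (fun x : V => x + int_vec R s).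
    by move=> x; apply: continuousD; [exact: cvg_id|exact: cst_continuous].
  exact.
apply/seteqP; split => x /=.
  by move=> [y Uy /esym/pi_torusP[s ys]]; exists s => //=; rewrite -ys.
by move=> [s _ /= Us]; exists (x + int_vec R s) => //; apply/esym/pi_torusP; exists s.
Qed.

(** [repr] need not be continuous. The image of a ball under the open projection is a neighbourhood,
    and periodicity replaces [repr] by a representative in that ball. *)
Lemma phase_continuous (g : V -> V -> R) :
  continuous (fun p : V * V => g p.1 p.2) ->
  (forall s x v, g (x + int_vec R s) v = g x v) ->
  continuous (fun p : phase R N => g (repr p.1) p.2).
Proof.
move=> cg g_per [t v]; apply/cvgrPdist_lt => /= eps e0.
have /nbhs_ballP[r /= r0 Hr] :
    \forall q \near (repr t, v), `|g (repr t) v - g q.1 q.2| < eps.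
  by move/cvgrPdist_lt: (cg (repr t, v)); apply.
exists (\pi_(torus R N) @` ball (repr t) r, ball v r).
  split => /=; last exact: nbhsx_ballx.
  apply: open_nbhs_nbhs; split; first by apply: pi_torus_open; exact: ball_open.
  by exists (repr t); [exact: ballxx|rewrite reprK].
move=> [t' v'] /= [[x' tx' <-] vv'].
by rewrite (@periodic_repr _ (g ^~ v')) //; exact: (Hr (x', v')).
Qed.

Lemma borel_phase_measurable (f : phase R N -> R) : continuous f ->
  measurable_fun [set: borel_phase R N] (f : borel_phase R N -> R).
Proof.
move=> /continuousP cf; apply: (measurability _ (RGenOpens.measurableE R)).
move=> _ [_ [a [b ->] <-]]; rewrite setTI; apply: sub_sigma_algebra.
exact/cf/interval_open.
Qed.

End Torus.

(** * Uniform probability measures on finite sequences of points *)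

Section EmpiricalMeasure.
Context d (T : measurableType d) (R : realType).
Variables (k : nat) (a : nat -> T).
Local Open Scope ereal_scope.

Definition empirical : set T -> \bar R :=
  mscale (k.+1%:R^-1%:nng : {nonneg R})%R (msum (fun n => \d_(a n)) k.+1).

HB.instance Definition _ := Measure.on empirical.

Lemma empirical_setT : empirical setT = 1.
Proof.
rewrite /empirical /mscale /= /msum.
rewrite (eq_bigr (fun=> 1)) => [|i _]; last exact: diracT.
by rewrite sumEFin sumr_const card_ord -EFinM mulVf.
Qed.

HB.instance Definition _ := Measure_isProbability.Build _ _ _ empirical empirical_setT.

Lemma integral_empirical (g : T -> R) : measurable_fun setT g ->
  \int[empirical]_x (g x)%:E = (k.+1%:R^-1 * \sum_(i < k.+1) g (a i))%R%:E.
Proof.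
move=> mg.
have pos (f : T -> \bar R) : measurable_fun setT f -> (forall x, 0 <= f x) ->
    \int[empirical]_x f x = (k.+1%:R^-1)%R%:E * \sum_(i < k.+1) f (a i).
  move=> mf f0; rewrite ge0_integral_mscale // ge0_integral_measure_sum //=.
  congr (_ * _); apply: eq_bigr => i _.
  by rewrite integral_dirac // diracT mul1e.
(* The function [g] may change sign: the nonnegative case is applied to its positive and negative
   parts. *)
have mG : measurable_fun setT (EFin \o g) by exact/measurable_EFinP.
rewrite integralE !pos //; [|exact: measurable_funeneg|exact: measurable_funepos].
under eq_bigr do rewrite funeposE -EFin_max.
under [in X in _ - X]eq_bigr do rewrite funenegE -EFinN -EFin_max.
rewrite !sumEFin -!EFinM -EFinB -mulrBr -sumrB.
congr ((_ * _)%R%:E); apply: eq_bigr => i _.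
by rewrite /Num.max; case: ltP => ?; case: ltP => ?; lra.
Qed.

End EmpiricalMeasure.

(** * Holonomic measures from closed paths, and nonnegativity of their action *)

Section HbarBound.
Local Open Scope quotient_scope.
Variables (R : realType) (N : nat).
Local Notation V := 'rV[R]_N.
Variables (h : R) (L : V -> V -> R).
Hypothesis h_gt0 : 0 < h.
Hypothesis L_continuous : continuous (fun p : V * V => L p.1 p.2).
Hypothesis L_periodic : periodic_x L.

Lemma lagrangian_measurable : measurable_fun [set: borel_phase R N]
  (fun p : borel_phase R N => L (repr p.1) p.2).
Proof. by apply: borel_phase_measurable; exact: phase_continuous. Qed.

(** Since [mu] has mass 1, the negative part integrates to at most [B]; the positive part may
    integrate to [+oo]. *)
Lemma le_integral_lagrangian (B : R) (mu : probability (borel_phase R N) R) :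
  0 <= B -> (forall x v, - B <= L x v) ->
  ((- B)%:E <= \int[mu]_(p in [set: borel_phase R N]) (L (repr p.1) p.2)%:E)%E.
Proof.
move=> B0 LB; rewrite integralE.
have mL : measurable_fun [set: borel_phase R N]
    (EFin \o (fun p : borel_phase R N => L (repr p.1) p.2)).
  by apply/measurable_EFinP; exact: lagrangian_measurable.
rewrite -[(- B)%:E]add0e; apply: leeD; first exact: integral_ge0.
rewrite EFinN leeN2.
have -> : B%:E = (\int[mu]_(p in [set: borel_phase R N]) (cst B%:E p))%E.
  rewrite integral_cst // -[LHS]mule1; congr (_ * _)%E.
  exact/esym/(probability_setT mu).
apply: ge0_le_integral => //=; first exact: measurable_funeneg.
move=> p _; rewrite funenegE -EFinN -EFin_max lee_fin ge_max B0 andbT.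
by have := LB (repr p.1) p.2; lra.
Qed.

(* The bound on [L] keeps the infimum off [-oo], where [fine] would return [0]. *)
Lemma Hbar_le (B c : R) (mu : probability (borel_phase R N) R) :
  0 <= B -> (forall x v, - B <= L x v) -> holonomic h mu ->
  (\int[mu]_(p in [set: borel_phase R N]) (L (repr p.1) p.2)%:E = c%:E)%E ->
  Hbar h L <= c.
Proof.
move=> B0 LB hmu muc; rewrite /Hbar; set I := ereal_inf _.
have Ic : (I <= c%:E)%E by apply: ereal_inf_lbound; exists mu.
have IB : ((- B)%:E <= I)%E.
  by apply: le_ereal_inf_tmp => _ [nu _ <-]; exact: le_integral_lagrangian.
by move: Ic IB; case: I => [r| |]; rewrite ?lee_fin //=.
Qed.

(** The velocity at [p i] leads exactly to [p i.+1], so the integral telescopes; the two endpoints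
    agree on the torus. *)
Lemma closed_path_holonomic (k : nat) (s : 'rV[int]_N) (p : nat -> V) :
  p 0%N = p k.+1 + int_vec R s ->
  holonomic h (empirical R k (fun i =>
    (\pi_(torus R N) (p i), h^-1 *: (p i.+1 - p i)) : borel_phase R N)).
Proof.
move=> p0 phi phi_c; have phipi_c : continuous (phi \o \pi_(torus R N)).
  exact/quotient_continuous.
have phipi_per t x : phi (\pi_(torus R N) (x + int_vec R t)) = phi (\pi_(torus R N) x).
  by congr phi; apply/esym/pi_torusP; exists t.
pose g (x v : V) := phi (\pi_(torus R N) (x + h *: v)) - phi (\pi_(torus R N) x).
have gE q : phi (tshift q.1 (h *: q.2)) - phi q.1 = g (repr q.1) q.2.
  by rewrite /g reprK.
have g_per t x v : g (x + int_vec R t) v = g x v.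
  by rewrite /g addrAC !phipi_per.
have g_c : continuous (fun q : V * V => g q.1 q.2).
  move=> q; apply: continuousB.
    apply: (@continuous_comp _ _ _ (fun q : V * V => q.1 + h *: q.2)
      (phi \o \pi_(torus R N))); last exact: phipi_c.
    apply: continuousD; first exact: cvg_fst.
    by apply: continuousZ; [exact: cst_continuous|exact: cvg_snd].
  by apply: (@continuous_comp _ _ _ fst (phi \o \pi_(torus R N)));
    [exact: cvg_fst|exact: phipi_c].
under eq_integral do rewrite gE.
rewrite integral_empirical; last first.
  by apply: borel_phase_measurable; exact: phase_continuous.
congr EFin; rewrite (eq_bigr (fun i : 'I_k.+1 =>
  phi (\pi_(torus R N) (p i.+1)) - phi (\pi_(torus R N) (p i)))) => [|i _].
  rewrite -(big_mkord xpredT (fun i =>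
    phi (\pi_(torus R N) (p i.+1)) - phi (\pi_(torus R N) (p i)))).
  by rewrite telescope_sumr // p0 phipi_per subrr mulr0.
rewrite /= (@periodic_repr _ _ _ (g ^~ _)) // /g scalerA divff ?gt_eqF // scale1r.
by rewrite [p i + _]addrC subrK.
Qed.

(** The mean of [L] along the path is its integral against a holonomic measure, hence at least
    [Hbar h L]. *)
Lemma closed_path_action_ge0 (B : R) (k : nat) (s : 'rV[int]_N) (p : nat -> V) :
  0 <= B -> (forall x v, - B <= L x v) -> p 0%N = p k.+1 + int_vec R s ->
  0 <= action h L k.+1 p.
Proof.
move=> B0 LB p0; have := Hbar_le B0 LB (closed_path_holonomic p0).
rewrite integral_empirical; last exact: lagrangian_measurable.
move=> /(_ _ erefl).
under eq_bigr => i _ do rewrite /= (@periodic_repr _ _ _ (L ^~ _)) //.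
rewrite /action sumrB sumr_const card_ord; set S := \sum_(i < k.+1) _ => HS.
by rewrite pmulr_rge0 // subr_ge0 -mulr_natr -ler_pdivlMr // mulrC.
Qed.

End HbarBound.

Lemma continuous2_comp (T U1 U2 W : topologicalType) (F : U1 -> U2 -> W)
    (f : T -> U1) (g : T -> U2) :
  continuous (fun p : U1 * U2 => F p.1 p.2) -> continuous f -> continuous g ->
  continuous (fun x => F (f x) (g x)).
Proof.
move=> cF cf cg x; apply: (@continuous2_cvg _ _ _ _ _ _ f g F).
- exact: (cF (f x, g x)).
- exact: cf.
- exact: cg.
Qed.

(** * The one-step cost of an admissible Lagrangian *)

Section StepCost.
Variables (R : realType) (N : nat).
Local Notation V := 'rV[R]_N.
Variables (h : R) (L : V -> V -> R).
Hypothesis h_gt0 : 0 < h.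
Hypothesis L_admissible : admissible_lagrangian L.

Definition step_cost (c : R) (x y : V) : R := h * (L x (h^-1 *: (y - x)) - c).

Lemma lagrangian_continuous : continuous (fun p : V * V => L p.1 p.2).
Proof. by case: L_admissible => -[]. Qed.

Lemma step_cost_continuous c : continuous (fun p : V * V => step_cost c p.1 p.2).
Proof.
have cv : continuous (fun p : V * V => h^-1 *: (p.2 - p.1)).
  move=> p; apply: (@continuous_comp _ _ _ (fun p : V * V => p.2 - p.1) ( *:%R h^-1)).
    by apply: continuousB; [exact: cvg_snd|exact: cvg_fst].
  exact: scaler_continuous.
have cL : continuous (fun p : V * V => L p.1 (h^-1 *: (p.2 - p.1))).
  by apply: (continuous2_comp lagrangian_continuous) => // p; exact: cvg_fst.
move=> p; apply: (@continuous_comp _ _ _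
  (fun p : V * V => L p.1 (h^-1 *: (p.2 - p.1)) - c) ( *%R h)).
  by apply: continuousB; [exact: cL|exact: cst_continuous].
exact: mulrl_continuous.
Qed.

Lemma step_cost_periodic c s x y :
  step_cost c (x + int_vec R s) (y + int_vec R s) = step_cost c x y.
Proof.
rewrite /step_cost (lagrangian_periodic L_admissible).
by rewrite opprD addrACA subrr addr0.
Qed.

Lemma norm_le_enorm (v : V) : `|v| <= enorm v.
Proof.
rewrite [leLHS]/Num.norm /= mx_normrE; apply: bigmax_le => [|[i j] _ /=].
  exact: sqrtr_ge0.
rewrite (ord1 i) -sqrtr_sqr ler_sqrt ?sumr_ge0 // => [|k _]; last exact: sqr_ge0.
by rewrite (bigD1 j) //= lerDl sumr_ge0 // => k _; exact: sqr_ge0.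
Qed.

Lemma step_cost_coercive c (A : R) : exists M : R, forall x y,
  step_cost c x y <= A -> `|y - x| <= M.
Proof.
have [r Hr] := lagrangian_superlinear L_admissible 1.
(* Beyond [r], superlinearity with slope 1 gives [enorm v < L x v], and the cost bound gives
   [L x v <= A / h + c]. So [enorm v] cannot exceed both [r] and [A / h + c]. *)
exists (h * (`|r| + `|A / h + c|)) => x y exy; set v := h^-1 *: (y - x).
have -> : y - x = h *: v by rewrite scalerA divff ?gt_eqF // scale1r.
rewrite normrZ gtr0_norm // ler_pM2l //; apply: le_trans (norm_le_enorm _) _.
have rr := ler_norm r; have AA := ler_norm (A / h + c).
have r0 := normr_ge0 r; have A0 := normr_ge0 (A / h + c).
rewrite leNgt; apply/negP => Hv.
have v0 : 0 < enorm v by lra.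
have /(Hr x) : r < enorm v by lra.
rewrite ltr_pdivlMr // mul1r => Lv.
have : L x v <= A / h + c by rewrite -lerBlDr ler_pdivlMr // mulrC.
by lra.
Qed.

(** With [c = 0] the step cost is [h * L], to which the lower bound for periodic coercive costs
    applies. *)
Lemma lagrangian_lower_bound : exists2 B : R, 0 <= B & forall x v, - B <= L x v.
Proof.
have [B HB] := cost_lower_bound (@step_cost_continuous 0)
  (@step_cost_periodic 0) (@step_cost_coercive 0).
exists (`|B| / h) => [|x v]; first by rewrite divr_ge0 // ltW.
have := HB x (x + h *: v); rewrite /step_cost subr0.
rewrite [x + _]addrC addrK scalerA mulVf ?gt_eqF // scale1r => HL.
by rewrite -mulNr ler_pdivrMr // mulrC; have := ler_norm B; lra.
Qed.

Lemma action_path_cost k p : action h L k p = path_cost (step_cost (Hbar h L)) k p.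
Proof. by rewrite /action mulr_sumr. Qed.

Lemma closed_path_cost_ge0 k s p : p 0%N = p k.+1 + int_vec R s ->
  0 <= path_cost (step_cost (Hbar h L)) k.+1 p.
Proof.
move=> p0; have [B B0 LB] := lagrangian_lower_bound.
rewrite -action_path_cost; apply: closed_path_action_ge0 B0 LB p0 => //.
  exact: lagrangian_continuous.
exact: lagrangian_periodic.
Qed.

End StepCost.

(** * A countable dense set of base points *)

Section RationalPoints.
Variables (R : realType) (N : nat).

(** Indices that encode no rational vector give the origin, which is harmless for density. *)
Definition rational_point (n : nat) : 'rV[R]_N :=
  map_mx ratr (odflt 0 (unpickle n : option 'rV[rat]_N)).

Lemma rational_point_dense (x : 'rV[R]_N) (delta : R) : 0 < delta ->
  exists n, `|x - rational_point n| < delta.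
Proof.
move=> d0.
have /choice[r Hr] : forall j : 'I_N, exists q : rat, `|x 0 j - ratr q| <= delta / 2.
  move=> j; have /rat_in_itvoo[q] : x 0 j - delta / 2 < x 0 j + delta / 2 by lra.
  by rewrite in_itv /= => /andP[? ?]; exists q; rewrite ler_norml; lra.
exists (pickle (\row_j r j)); apply: (@le_lt_trans _ _ (delta / 2)); last lra.
rewrite [leLHS]/Num.norm /= mx_normrE; apply: bigmax_le => [|[i j] _ /=]; first lra.
by rewrite /rational_point pickleK (ord1 i) !mxE.
Qed.

End RationalPoints.

(** * The separating subaction on the universal cover *)

Section SeparatingSubaction.
Variables (R : realType) (N : nat).
Local Notation V := 'rV[R]_N.
Variables (h : R) (L : V -> V -> R).
Hypothesis h_gt0 : 0 < h.
Hypothesis L_admissible : admissible_lagrangian L.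

Let e : V -> V -> R := step_cost h L (Hbar h L).
Let D : V -> V -> R := torus_cost e.
Let e_continuous : continuous (fun p : V * V => e p.1 p.2).
Proof. exact: step_cost_continuous. Qed.
Let e_periodic s x y : e (x + int_vec R s) (y + int_vec R s) = e x y.
Proof. exact: step_cost_periodic. Qed.
Let e_coercive (A : R) : exists M : R, forall x y, e x y <= A -> `|y - x| <= M.
Proof. exact: step_cost_coercive. Qed.

(** A negative cycle would lift, with slack equal to its absolute value, to a path closed modulo
    integer vectors whose cost is still negative. *)
Lemma chain_cycle_ge0 x l : 0 <= chain_cost D x l x.
Proof.
rewrite leNgt; apply/negP => lt0.
have [|k [s [p [p0 pk]]]] := @chain_lift _ _ _ e_periodic
  x l x (- chain_cost D x l x); first by rewrite oppr_gt0.
rewrite subrr; apply/negP; rewrite -leNgt.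
by apply: (@closed_path_cost_ge0 _ _ _ _ _ _ _ s) => //; rewrite p0 pk.
Qed.

Definition mane_potential (n : nat) : V -> R := potential D (@rational_point R N n).

Definition separating_subaction : V -> R := dyadic_average mane_potential.

Local Notation U := separating_subaction.

Lemma mane_potential_bounded : exists B : R, forall n x, `|mane_potential n x| <= B.
Proof.
have [K HK] := torus_cost_bounded e_continuous e_periodic e_coercive.
exists K => n x; rewrite ler_norml; apply/andP; split.
  apply: le_trans (potential_ge chain_cycle_ge0 _ _).
  by rewrite lerN2; apply: le_trans (HK x (rational_point R N n)); exact: ler_norm.
apply: le_trans (potential_leD chain_cycle_ge0 _ _) _.
by apply: le_trans (HK (rational_point R N n) x); exact: ler_norm.
Qed.

Lemma separating_subaction_le (a : R) x y :
  (forall n, mane_potential n y - mane_potential n x <= a) -> U y - U x <= a.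
Proof. by have [B HB] := mane_potential_bounded; exact: dyadic_average_le HB _ _ _. Qed.

Lemma separating_subaction_periodic s x : U (x + int_vec R s) = U x.
Proof.
congr (limn _); apply/funext => n; apply: eq_bigr => i _; congr (_ * _).
have per z : D z (x + int_vec R s) = D z x.
  exact: (torus_cost_periodic_r e_continuous e_periodic e_coercive).
apply/eqP; rewrite eq_le -[leRHS]addr0 -[X in _ && (_ <= X)]addr0.
by apply/andP; split; apply: (potential_le_r chain_cycle_ge0) => z; rewrite per addr0.
Qed.

(** One modulus of continuity of [D] serves all the potentials, because moving the endpoint affects
    only the last step of a chain. *)
Lemma separating_subaction_continuous : continuous U.
Proof.
move=> x; apply/(@cvgrPdist_le _ _ _ (nbhs x) (nbhs_filter x)) => eps e0.
have [d d0 Hd] := torus_cost_uniform e_continuous e_periodic e_coercive e0.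
have close y z : `|y - z| < d -> U z - U y <= eps.
  move=> yz; apply: separating_subaction_le => n; rewrite lerBlDl.
  apply: (potential_le_r chain_cycle_ge0) => w.
  by apply: Hd => //; rewrite subrr normr0.
apply/nbhs_ballP; exists d => //= y; rewrite -ball_normE /= => xy.
rewrite ler_norml; have := close _ _ xy; rewrite distrC in xy.
by have := close _ _ xy; lra.
Qed.

Lemma separating_subaction_leD x y : U y - U x <= D x y.
Proof.
apply: separating_subaction_le => n; rewrite lerBlDl.
exact: (potential_step chain_cycle_ge0).
Qed.

Lemma separating_subaction_le_cost x y : U y - U x <= e x y.
Proof.
exact: le_trans (separating_subaction_leD x y)
  (torus_cost_le e_continuous e_periodic e_coercive x y).
Qed.

Lemma calibrated_potential_le0 x y : U y - U x = e x y -> potential D x x <= 0.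
Proof.
move=> Uxy; have [B HB] := mane_potential_bounded.
have step n : mane_potential n y - mane_potential n x = e x y.
  apply: (dyadic_average_eq HB _ Uxy) => m; rewrite lerBlDl.
  apply: le_trans (potential_step chain_cycle_ge0 _ x y) _.
  by rewrite lerD2l; exact: (torus_cost_le e_continuous e_periodic e_coercive).
(* Replacing [x] by a nearby rational base point costs [eps] twice, in [le1] and in [le2].
   Calibration then yields [potential D x x <= 2 * eps], absurd for a third of a positive number. *)
rewrite leNgt; apply/negP => S0; pose eps := potential D x x / 3.
have e0 : 0 < eps by rewrite /eps; lra.
have [d d0 Hd] := torus_cost_uniform e_continuous e_periodic e_coercive e0.
have [n xn] := rational_point_dense x d0.
have le1 : mane_potential n y <= potential D x y + eps.
  apply: (potential_le_l chain_cycle_ge0) => z.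
  by apply: Hd; rewrite ?subrr ?normr0.
have le2 : potential D x x <= mane_potential n x + eps.
  apply: (potential_le_l chain_cycle_ge0) => z.
  by apply: Hd; rewrite ?subrr ?normr0 // distrC.
have le3 := potential_leD chain_cycle_ge0 x y.
have le4 := torus_cost_le e_continuous e_periodic e_coercive x y.
by have := step n; rewrite /eps in le1 le2; rewrite /D in le3 le1 le2 S0; lra.
Qed.

(** A nearly optimal cycle lifts to a path of action below [eps]; nonnegativity for closed paths
    supplies the other half of the absolute value. *)
Lemma potential_le0_nonwandering (t : torus R N) :
  potential D (repr t) (repr t) <= 0 -> nonwandering h L t.
Proof.
move=> S0 eps e0; have e20 : 0 < eps / 2 by lra.
have [l Hl] := potential_chain D (repr t) (repr t) e20.
have [k [s [p [p0 pk Hp]]]] :=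
  chain_lift e_periodic (repr t) l (repr t) e20.
exists k.+1, s, p; split => //; rewrite action_path_cost ger0_norm.
  by move: Hp; rewrite -/D -/e; lra.
by apply: (@closed_path_cost_ge0 _ _ _ _ _ _ _ s) => //; rewrite p0 pk.
Qed.

(** Along a closed path the increments of [U] sum to zero, so the action is the sum of the
    nonnegative defects [e - (U p' - U p)] of its steps. If it is small, so is the defect of the
    first step. *)
Lemma nonwandering_calibrated (t : torus R N) (eps : R) : nonwandering h L t ->
  0 < eps -> exists y, e (repr t) y - eps < U y - U (repr t).
Proof.
move=> nw e0; have [[|k] [s [p []]]] := nw _ e0; first by [].
move=> _ p0 pk; rewrite action_path_cost => /ltr_normlW.
rewrite -(subr0 (path_cost _ _ _)) -[X in _ - X](subrr (U (p 0%N))).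
rewrite [X in _ - (X - _)](_ : _ = U (p k.+1)); last first.
  by rewrite p0 pk separating_subaction_periodic.
rewrite -(telescope_sumr (U \o p)) // big_mkord -sumrB big_ord_recl /=.
set S := \sum_(i < k) _; have S0 : 0 <= S.
  by apply: sumr_ge0 => i _; rewrite subr_ge0; exact: separating_subaction_le_cost.
(* The path starts at [repr t + s]; its first step is moved back to start at [repr t]. *)
move=> small; exists (p 1%N - int_vec R s).
rewrite -(e_periodic s) subrK -p0.
have -> : U (p 1%N - int_vec R s) = U (p 1%N).
  by rewrite -(separating_subaction_periodic s) subrK.
have -> : U (repr t) = U (p 0%N) by rewrite p0 separating_subaction_periodic.
by move: small S0; rewrite -/e; lra.
Qed.

Lemma separating_max_exists (x : V) : exists v : V, forall w : V,
  U (x + h *: w) - U x - h * L x w <= U (x + h *: v) - U x - h * L x v.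
Proof.
pose G (v : V) : R := U (x + h *: v) - U x - h * L x v.
have eG v : e x (x + h *: v) = h * L x v - h * Hbar h L.
  rewrite /e /step_cost [x + _]addrC addrK scalerA mulVf ?gt_eqF //.
  by rewrite scale1r mulrBr.
have [K HK] := torus_cost_bounded e_continuous e_periodic e_coercive.
(* If [G 0 <= G v], then [h * L x v] is at most [K - G 0], as the increment of [U] is at most [D],
   hence at most [K]. Coercivity confines such [v] to a compact ball. *)
have [M HM] := e_coercive (K - G 0 - h * Hbar h L).
have GM v : G 0 <= G v -> `|v| <= M / h.
  move=> Gv; rewrite ler_pdivlMr // mulrC -[h in h * _]gtr0_norm // -normrZ.
  have -> : h *: v = x + h *: v - x by rewrite [x + _]addrC addrK.
  apply: HM; rewrite eG; move: Gv; rewrite {2}/G.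
  have := separating_subaction_leD x (x + h *: v).
  by have := HK x (x + h *: v); rewrite -/D ler_norml => /andP[]; lra.
have cL : continuous (L x).
  apply: (continuous2_comp (lagrangian_continuous L_admissible)) => w.
    exact: cst_continuous.
  exact: cvg_id.
have cU : continuous (fun v : V => U (x + h *: v)).
  move=> v; apply: (@continuous_comp _ _ _ (fun v : V => x + h *: v) U).
    apply: continuousD; first exact: cst_continuous.
    by apply: continuousZ; [exact: cst_continuous|exact: cvg_id].
  exact: separating_subaction_continuous.
have cG : continuous G.
  move=> v; apply: (@continuousB R R^o V); last first.
    apply: (@continuous_comp _ _ _ (L x) ( *%R h)); last exact: mulrl_continuous.
    exact: cL.
  by apply: (@continuousB R R^o V); [exact: cU|exact: cst_continuous].
have [v _ Hv] : exists2 v : V, v \in [set v : V | `|v| <= M / h] &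
    forall w, w \in [set v : V | `|v| <= M / h] -> G w <= G v.
  apply: EVT_max_rV; last exact: continuous_subspaceT.
    by exists 0; exact: GM.
  exact: closed_ball0_compact.
exists v => w; change (G w <= G v).
have [wM|Mw] := leP `|w| (M / h); first by apply: Hv; rewrite inE.
have G0v : G 0 <= G v by apply: Hv; rewrite inE; exact: GM.
by apply: le_trans G0v; rewrite leNgt; apply/negP => /ltW/GM; rewrite leNgt Mw.
Qed.

End SeparatingSubaction.

(** * Descent to the torus and the separation property *)

Unset Implicit Arguments.

Theorem theorem16 (R : realType) (N : nat) (L : 'rV[R]_N -> 'rV[R]_N -> R)
    (h : R) (hL : admissible_lagrangian L) (h_gt0 : 0 < h) :
  exists u : torus R N -> R, continuous u /\
    forall x : torus R N, exists m : R,
      [/\ is_max [set u (tshift x (h *: v)) - u x - h * L (repr x) v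
                   | v in [set: 'rV[R]_N]] m,
          m <= - (h * Hbar h L)
        & m = - (h * Hbar h L) <-> nonwandering h L x].
Proof.
pose U := separating_subaction h L.
have U_per s y : U (y + int_vec R s) = U y by exact: separating_subaction_periodic.
exists (U \o repr); split.
  apply: repr_comp_continuous; first exact: separating_subaction_continuous.
  by move=> x y /eqP/pi_torusP[s ->]; rewrite U_per.
move=> t; set x := repr t.
have uE v : (U \o repr) (tshift t (h *: v)) = U (x + h *: v).
  exact: periodic_repr.
have cost v : step_cost h L (Hbar h L) x (x + h *: v) = h * L x v - h * Hbar h L.
  rewrite /step_cost [x + _]addrC addrK scalerA mulVf ?gt_eqF //.
  by rewrite scale1r mulrBr.
have [v Hv] := separating_max_exists h_gt0 hL x.
exists (U (x + h *: v) - U x - h * L x v).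
have le_m : U (x + h *: v) - U x - h * L x v <= - (h * Hbar h L).
  have := separating_subaction_le_cost h_gt0 hL x (x + h *: v).
  by rewrite cost -/U; lra.
split; [|exact: le_m|].
  split; first by exists v => //; rewrite uE.
  by move=> _ [w _ <-]; rewrite uE; exact: Hv.
split => [mE|nw].
  apply: potential_le0_nonwandering => //.
  apply: (@calibrated_potential_le0 _ _ _ _ _ _ _ (x + h *: v)) => //.
  by rewrite cost -/U; lra.
(* If the maximum fell short of the bound, taking the gap as [eps] in [nonwandering_calibrated]
   would produce a velocity whose value exceeds the maximum. *)
apply/eqP; rewrite eq_le le_m /= leNgt; apply/negP => m_lt.
have [|y] := @nonwandering_calibrated _ _ _ _ h_gt0 hL t
  (- (h * Hbar h L) - (U (x + h *: v) - U x - h * L x v)) nw.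
  by lra.
have -> : y = x + h *: (h^-1 *: (y - x)).
  by rewrite scalerA divff ?gt_eqF // scale1r [x + _]addrC subrK.
by rewrite -/x cost -/U; have := Hv (h^-1 *: (y - x)); rewrite -/U; lra.
Qed.
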